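(* Let $n\ge3$ and $k\ge3$, and let $\ell(n,k)$ denote the maximum period of a negative orientable sequence of order $n$ over $\mathbb{Z}_k$. Then, with $s_k(n-1)$ as defined in the context, \[ \frac{s_k(n-1)}{\ell(n,k)}\rightarrow 1 \text{ as } n\rightarrow\infty \ (k \text{ fixed}),\qquad \frac{s_k(n-1)}{\ell(n,k)}\rightarrow 1 \text{ as } k\rightarrow\infty\ (n\text{ fixed}). \]
   Context: A $k$-ary sequence is a periodic sequence $S=(s_i)$ with entries in $\mathbb{Z}_k$; its period is the least positive $p$ with $s_{i+p}=s_i$ for all $i$. Write $\mathbf{s}_n(i)=(s_i,\dots,s_{i+n-1})$. $S$ is an $n$-window sequence if $\mathbf{s}_n(i)=\mathbf{s}_n(j)$ implies $i\equiv j\pmod p$. A negative orientable sequence of order $n$ is a $k$-ary $n$-window sequence with $\mathbf{s}_n(i)\neq-\mathbf{s}_n(j)^R$ for all $i,j$, where $\mathbf{u}^R$ is the reverse of $\mathbf{u}$ and negation is modulo $k$. Let $\delta=1$ if $k$ is odd and $\delta=2$ if $k$ is even, and write $n=2^tm$ with $m$ odd. Define $s_k(n-1)=\frac{k^n-\delta(n(k^{(n-1)/2}-1)+1)}{2}$ if $n$ is odd, and $s_k(n-1)=\frac{k^n - \frac{nk^{(n-2)/2}}{2}(\delta^2+k) +n\delta k^{(m-1)/2} - m\delta(k^{(m-1)/2}-1)-\delta}{2}$ if $n$ is even. *)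

(* Defs.v *)
From HB Require Import structures.
From mathcomp Require Export all_boot all_order all_algebra.
From mathcomp Require Export all_classical all_reals.
From mathcomp Require Export topology normedtype sequences.

Set Implicit Arguments.
Unset Strict Implicit.
Unset Printing Implicit Defensive.

Import Order.TTheory GRing.Theory Num.Theory.

Local Open Scope classical_set_scope.
Local Open Scope ring_scope.

(* The alphabet 'Z_k is the ring of integers modulo k only for 1 < k. *)
Definition is_period (k : nat) (S : nat -> 'Z_k) (p : nat) : Prop :=
  [/\ (0 < p)%N,
      forall i, S (i + p)%N = S i
    & forall q, (0 < q)%N -> (forall i, S (i + q)%N = S i) -> (p <= q)%N].

Definition window (k : nat) (S : nat -> 'Z_k) (n i : nat) : seq 'Z_k :=
  [seq S (i + j)%N | j <- iota 0 n].

Definition window_sequence (k n : nat) (S : nat -> 'Z_k) (p : nat) : Prop :=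
  is_period S p /\
  forall i j, window S n i = window S n j -> i = j %[mod p].

Definition negative_orientable (k n : nat) (S : nat -> 'Z_k) (p : nat) : Prop :=
  window_sequence n S p /\
  forall i j, window S n i <> [seq - x | x <- rev (window S n j)].

Definition is_max_period (n k L : nat) : Prop :=
  (exists S : nat -> 'Z_k, negative_orientable n S L) /\
  (forall (S : nat -> 'Z_k) (p : nat), negative_orientable n S p -> (p <= L)%N).

(* The maximum exists whenever 0 < n and 2 < k (max_periodP below); the default
   value 0 is only taken outside of that range. *)
Definition max_period (n k : nat) : nat :=
  xget 0%N [set L | is_max_period n k L].

Definition delta (k : nat) : nat := if odd k then 1%N else 2%N.

(* [s_val R k r] is s_k(r), so that n = r + 1; here m is the odd part of n, and
   all natural-number divisions are exact. *)
Definition s_val (R : realType) (k r : nat) : R :=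
  let n := r.+1 in
  let m := (n %/ 2 ^ logn 2 n)%N in
  let d : R := (delta k)%:R in
  let K : R := k%:R in
  if odd n then
    (K ^+ n - d * (n%:R * (K ^+ ((n - 1) %/ 2) - 1) + 1)) / 2
  else
    (K ^+ n - n%:R * K ^+ ((n - 2) %/ 2) / 2 * (d ^+ 2 + K)
       + n%:R * d * K ^+ ((m - 1) %/ 2)
       - m%:R * d * (K ^+ ((m - 1) %/ 2) - 1) - d) / 2.

Lemma window_sequence_le (k n : nat) (S : nat -> 'Z_k) (p : nat) :
  (1 < k)%N -> window_sequence n S p -> (p <= k ^ n)%N.
Proof.
move=> k1 [_ inj].
have sz i : size (window S n i) == n by rewrite size_map size_iota.
pose f (i : 'I_p) : n.-tuple 'Z_k := Tuple (sz i).
have finj : injective f.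
  move=> i j /(congr1 val) /= /inj.
  by rewrite !modn_small // => /val_inj.
have := leq_card f finj.
by rewrite card_ord card_tuple card_ord Zp_cast.
Qed.

Lemma negative_orientable_const1 (k n : nat) :
  (0 < n)%N -> (2 < k)%N -> negative_orientable n (fun=> 1 : 'Z_k) 1.
Proof.
move=> n0 k2; split; first by split=> // i j; rewrite !modn1.
move=> i j /(congr1 (fun s => nth 0 s 0)).
rewrite /window (nth_map 0%N) ?size_iota// (nth_map 0) ?size_rev ?size_map ?size_iota//.
rewrite nth_rev ?size_map ?size_iota// (nth_map 0%N) ?size_iota; last first.
  by rewrite ltn_subrL.
move=> /eqP; rewrite -subr_eq0 opprK -(natrD _ 1 1) => /eqP.
move=> /(congr1 (@nat_of_ord _)); rewrite val_Zp_nat ?modn_small//.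
exact: ltnW.
Qed.

Lemma max_periodP (n k : nat) :
  (0 < n)%N -> (2 < k)%N -> is_max_period n k (max_period n k).
Proof.
move=> n0 k2.
suff [L HL] : exists L, is_max_period n k L.
  exact: (@xgetPex _ 0%N [set L | is_max_period n k L] (ex_intro _ L HL)).
pose P p := `[< exists S : nat -> 'Z_k, negative_orientable n S p >].
have exP : exists p, P p.
  by exists 1%N; apply/asboolP; eexists; exact: negative_orientable_const1.
have ubP p : P p -> (p <= k ^ n)%N.
  by move=> /asboolP[S [HS _]]; apply: window_sequence_le HS; exact: ltnW.
case: (ex_maxnP exP ubP) => L /asboolP exL maxL.
by exists L; split=> // S p HS; apply: maxL; apply/asboolP; exists S.
Qed.

(* Main.v *)
Require Import Defs.
From mathcomp Require Import all_boot all_order all_algebra all_fingroup.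
From mathcomp Require Import all_classical all_reals.
From mathcomp Require Import topology normedtype sequences.
From mathcomp Require Import zify ring lra.

(** Let [N u] be the reversed negation of a word [u] of length [n] over [Z_k].
    The windows of a negative orientable sequence are disjoint from their
    images under [N], so its period is at most [k^n / 2]. Conversely, give the
    letter [a <> 0] the weight [2a] and the letter [0] the weight [k], so that
    the weights of [u] and [N u] add up to [2kn], and let [E] consist of the
    words lighter than [N u], with ties broken by an arbitrary ranking of
    rotation classes. Then [E] is a union of rotation classes, which are cycles
    in the de Bruijn graph. Replacing a letter by [1] lowers the weight, so
    these cycles can all be joined into a single one, whose length [#|E|] is
    then the period of a negative orientable sequence. Words outside [E] and
    [N E] satisfy [N u = rot j u] for some [j]; they split into two blocks
    fixed by [N], so there are at most [n k^(n/2+1)] of them. Hence twice the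
    maximal period, like [2 s_k(n-1)], is [k^n + O(n k^(n/2+1))]. *)

Set Implicit Arguments.
Unset Strict Implicit.
Unset Printing Implicit Defensive.

Import Order.TTheory GRing.Theory Num.Theory.
Import numFieldNormedType.Exports.

(** * Joining rotation classes into longer cycles of the de Bruijn graph *)

Section CycleJoining.
Variables (A : finType) (m : nat).
Local Notation word := (m.+1.-tuple A).
Implicit Types (u v : word) (E : {set word}) (s : {perm word}).

Lemma rot1_tuple_inj : injective (fun u => rot_tuple 1 u).
Proof. by move=> u v /(congr1 val) /rot_inj /val_inj. Qed.

Definition rot_perm : {perm word} := perm rot1_tuple_inj.

Lemma rot_permE u : rot_perm u = rot 1 u :> seq A.
Proof. by rewrite permE. Qed.

(** Each arc from [u] to [s u] lies in the de Bruijn graph, so the cycles of [s] partition its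
    vertices into closed walks. *)
Definition debruijn_perm s := [forall u, take m (s u) == behead u :> seq A].

Lemma rot_perm_debruijn : debruijn_perm rot_perm.
Proof.
apply/forallP => u; rewrite rot_permE.
case: u => [[|a w]] //= /eqP[sz].
by rewrite rot1_cons -cats1 -sz take_size_cat.
Qed.

(* The condition on [porbit] says that no two cycles of [s] inside [E] can be
   joined any more: swapping the images of two words with a common tail merges
   their cycles, so it holds when [s] has as few cycles as possible. *)
Lemma joined_perm_ex E :
    (forall u, (rot_perm u \in E) = (u \in E)) ->
  exists s, [/\ debruijn_perm s, forall u, (s u \in E) = (u \in E)
    & forall u v, u \in E -> v \in E ->
        behead u = behead v :> seq A -> u \in porbit s v].
Proof.
move=> rotE.
pose P s := debruijn_perm s && [forall u, (s u \in E) == (u \in E)].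
have P0 : P rot_perm.
  by rewrite /P rot_perm_debruijn; apply/forallP => u; rewrite rotE.
case: (@arg_minnP _ rot_perm P (fun s => #|porbits s|) P0).
move=> s /andP[/forallP sB /forallP sE] smin.
exists s; split=> [|u|u v uE vE uv]; first exact/forallP.
  exact/eqP/sE.
apply: contraT => nuv.
have := porbits_mul_tperm s u v; rewrite /= nuv.
have -> : u != v by apply: contraNneq nuv => ->; exact: porbit_id.
rewrite addn1 addn2 => -[lt_s].
suff /smin : P (tperm u v * s)%g by rewrite -lt_s ltnn.
apply/andP; split; apply/forallP => w; rewrite permM.
  by case: tpermP => [->|->|_ _]; rewrite ?uv -?uv //; rewrite uv.
by case: tpermP => [->|->|_ _] //; rewrite (eqP (sE _)) uE vE.
Qed.

Lemma iter_rot_perm u i : i <= m.+1 -> (rot_perm ^+ i)%g u = rot i u :> seq A.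
Proof.
elim: i => [|i IH] im; first by rewrite expg0 perm1 rot0.
by rewrite expgSr permM rot_permE (IH (ltnW im)) -rotS ?size_tuple.
Qed.

Lemma porbit_rot_permP u v :
  v \in porbit rot_perm u -> exists2 j, j < m.+1 & v = rot j u :> seq A.
Proof.
move=> /porbitP[i ->].
have r1 : (rot_perm ^+ m.+1 = 1)%g.
  apply/permP => w; apply/val_inj; rewrite perm1 /= iter_rot_perm //.
  by rewrite rot_oversize ?size_tuple.
exists (i %% m.+1); first by rewrite ltn_pmod.
rewrite {1}(divn_eq i m.+1) expgD mulnC expgM r1 expg1n mul1g.
by rewrite iter_rot_perm // ltnW // ltn_pmod.
Qed.

(** The [s]-preimage of [rot_perm u] lies in [E] and has the same tail as [u], so the joining
    property puts it on the cycle of [u], and [rot_perm u] with it. *)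
Lemma porbit_joined_rot E s :
    (forall u, (rot_perm u \in E) = (u \in E)) -> debruijn_perm s ->
    (forall u, (s u \in E) = (u \in E)) ->
    (forall u v, u \in E -> v \in E ->
        behead u = behead v :> seq A -> u \in porbit s v) ->
  forall u i, u \in E ->
    porbit s ((rot_perm ^+ i)%g u) = porbit s u.
Proof.
move=> rotE /forallP sB sE joined u i uE.
elim: i => [|i IH]; first by rewrite expg0 perm1.
rewrite -{}IH expgSr permM.
have vE : (rot_perm ^+ i)%g u \in E.
  by elim: i => [|i IH]; rewrite ?expg0 ?perm1 // expgSr permM rotE.
move: (_ u) vE => {uE}u uE.
have sv : s ((s^-1)%g (rot_perm u)) = rot_perm u by rewrite permKV.
set v := (s^-1)%g _ in sv.
have vE : v \in E by rewrite -sE sv rotE.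
rewrite -sv -[s v]/((s ^+ 1)%g v) porbit_perm.
apply/eqP; rewrite eq_porbit_mem joined //.
by rewrite -(eqP (sB v)) sv (eqP (forallP rot_perm_debruijn u)).
Qed.

(** * Reading a sequence off a cycle *)

Section Sequence.
Variables (s : {perm word}) (w0 : word).
Hypothesis sB : debruijn_perm s.

Lemma nth_debruijn x0 u j : j < m -> nth x0 (s u) j = nth x0 u j.+1.
Proof.
move=> jm; rewrite -(nth_take x0 jm) (eqP (forallP sB u)).
by rewrite nth_behead.
Qed.

(** Each application of [s] shifts the word left by one letter, so the first letters of successive
    iterates spell out the word at which the reading starts. *)
Lemma nth_debruijn_iter x0 i j :
  j <= m -> nth x0 (iter (i + j) s w0) 0 = nth x0 (iter i s w0) j.
Proof.
elim: j i => [|j IH] i jm; first by rewrite addn0.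
by rewrite addnS -addSn IH ?(ltnW jm) //= nth_debruijn.
Qed.

Lemma iter_perm_inj i j :
  iter i s w0 = iter j s w0 -> i = j %[mod #|porbit s w0|].
Proof.
set p := #|_|.
have p0 : 0 < p by rewrite lt0n card_porbit_neq0.
have iterp q : iter (q * p) s w0 = w0.
  by elim: q => // q IH; rewrite mulSn addnC iterD iter_porbit.
have modp q : iter q s w0 = iter (q %% p) s w0.
  by rewrite {1}(divn_eq q p) addnC iterD iterp.
rewrite modp (modp j) => ij.
have nt q : q < p -> nth w0 (traject s w0 p) q = iter q s w0.
  by move=> qp; rewrite nth_traject.
apply/eqP; rewrite -(nth_uniq w0 _ _ (uniq_traject_porbit s w0));
  by rewrite ?size_traject ?nt ?ltn_pmod // ij.
Qed.

End Sequence.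
End CycleJoining.

(** * The set [E] of light words and its connectedness *)

Section PositiveWords.
Variables (k' m : nat).
Local Notation k := k'.+3.
Local Notation word := (m.+1.-tuple 'Z_k).
Implicit Types (a : 'Z_k) (u v : word).

Definition letter_weight a : nat := if a == 0%R then k else (2 * a)%N.

Lemma letter_weightN a : letter_weight (- a)%R + letter_weight a = 2 * k.
Proof.
rewrite /letter_weight oppr_eq0; have [_|a0] := eqVneq; first by lia.
have a_gt0 : 0 < (a : nat) by rewrite lt0n; apply: contra a0 => /eqP a0; apply/eqP/val_inj.
have -> : ((- a)%R : nat) = (k - a)%N.
  by rewrite /= modn_small // ltn_subrL a_gt0.
by rewrite -mulnDr subnK // ltnW // (ltn_ord a).
Qed.

(** The letter [1] weighs 2, the letter [0] weighs [k >= 3], and all others at least 4. *)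
Lemma letter_weight_gt1 a : a != 1%R -> letter_weight 1%R < letter_weight a.
Proof.
move=> a1; rewrite {1}/letter_weight /= /letter_weight modn_small //.
have [//|a0] := eqVneq.
have : (a : nat) != 0 by apply: contra a0 => /eqP a0; apply/eqP/val_inj.
have : (a : nat) != 1.
  by apply: contra a1 => /eqP a1; apply/eqP/val_inj; rewrite /= a1 modn_small.
by case: (a : nat) => [|[|q]] // _ _; rewrite ltn_pmul2l.
Qed.

Definition weight (w : seq 'Z_k) : nat := \sum_(a <- w) letter_weight a.

Definition negrev u : word := [tuple of map -%R%R (rev u)].

Lemma negrevK : involutive negrev.
Proof.
move=> u; apply/val_inj; rewrite /= map_rev -map_comp map_rev revK.
by rewrite (eq_map (g := id)) ?map_id // => a /=; rewrite opprK.
Qed.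

Lemma weight_negrev u : weight (negrev u) + weight u = m.+1 * (2 * k).
Proof.
rewrite /weight big_map (perm_big u) ?perm_rev // -big_split /=.
rewrite (eq_bigr (fun=> 2 * k)); last by move=> a _; exact: letter_weightN.
by rewrite big_const_seq count_predT size_tuple iter_addn_0 mulnC.
Qed.

Lemma weight_rot j (w : seq 'Z_k) : weight (rot j w) = weight w.
Proof. by apply: perm_big; rewrite perm_rot. Qed.

(** An injective numbering of the rotation classes, used to break ties of weight. *)
Definition class_rank u : nat := enum_rank (porbit (rot_perm _ m) u).

Lemma class_rank_rot u : class_rank (rot_perm _ _ u) = class_rank u.
Proof.
by rewrite /class_rank -[rot_perm _ _ u]/((rot_perm _ _ ^+ 1)%g u) porbit_perm.
Qed.

(** Reversal turns a rotation into its inverse; hence [negrev] permutes the rotation classes. *)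
Lemma negrev_rot u : rot_perm _ _ (negrev (rot_perm _ _ u)) = negrev u.
Proof.
apply/val_inj; rewrite /= rot_permE /= rot_permE.
by rewrite rev_rot map_rotr rotrK.
Qed.

Definition positive_words : {set word} :=
  [set u : word | (weight u < weight (negrev u)) ||
    (weight u == weight (negrev u)) && (class_rank u < class_rank (negrev u))]%SET.

Local Notation E := positive_words.

Lemma positive_words_rot u : (rot_perm _ _ u \in E) = (u \in E).
Proof.
have W v : weight (rot_perm _ _ v) = weight v.
  by rewrite rot_permE weight_rot.
rewrite !inE W class_rank_rot.
by rewrite -(W (negrev _)) -(class_rank_rot (negrev _)) negrev_rot.
Qed.

Lemma positive_words_negrev u : u \in E -> negrev u \notin E.
Proof.
rewrite !inE negrevK eq_sym.
by case: (ltngtP (weight u)) => //= _; case: ltngtP.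
Qed.

(** The weights of a word and its [negrev] have a constant sum: [u] weighs at most half of it, so
    [v] weighs strictly less than half. *)
Lemma positive_words_lt u v : u \in E -> weight v < weight u -> v \in E.
Proof.
rewrite !inE; have := weight_negrev u; have := weight_negrev v => nv nu uE vu.
have {uE}: weight u <= weight (negrev u).
  by case/orP: uE => [/ltnW //|/andP[/eqP-> _]].
move: nu nv; move: (weight _) (weight _) (weight (negrev u)) (weight (negrev v)) vu.
by move=> a b c d ba e f g; apply/orP; left; lia.
Qed.

Definition ones : word := [tuple of nseq m.+1 1%R].

Lemma ones_positive : ones \in E.
Proof.
have := weight_negrev ones.
have w1 : weight ones = m.+1 * 2.
  by rewrite /weight big_nseq iter_addn_0 mulnC /letter_weight /= modn_small.
rewrite inE w1; move: (weight _) => W eqW.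
(* Here [W] is [m.+1] times [2k - 2], and [2k - 2 >= 4] exceeds 2. *)
by apply/orP; left; nia.
Qed.

(** Induction on weight: rotate a letter other than [1] to the front and replace it by [1]. The new
    word is lighter, hence still in [E], and its unchanged tail keeps it on the same cycle. *)
Lemma porbit_joined_ones (s : {perm word}) :
    debruijn_perm s -> (forall u, (s u \in E) = (u \in E)) ->
    (forall u v, u \in E -> v \in E ->
        behead u = behead v :> seq 'Z_k -> u \in porbit s v) ->
  forall u, u \in E -> porbit s u = porbit s ones.
Proof.
move=> sB sE joined u.
have [n] := ubnP (weight u); elim: n u => // n IH u un uE.
have [/all_pred1P u1|] := boolP (all (pred1 (1%R : 'Z_k)) u).
  by congr porbit; apply/val_inj; rewrite /= u1 size_tuple.
rewrite -has_predC => /(has_nthP 1%R)[i iu /= ai].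
have im : i < m.+1 by rewrite -(size_tuple u).
pose v : word := (rot_perm _ _ ^+ i)%g u.
have v_rot : v = rot i u :> seq _ by rewrite iter_rot_perm // ltnW.
have rotE j : (rot_perm _ _ ^+ j)%g u \in E.
  by elim: j => [|j IHj]; rewrite ?expg0 ?perm1 // expgSr permM positive_words_rot.
have vE : v \in E by exact: rotE.
pose v' : word := [tuple of 1%R :: behead v].
have v_cons : v = nth 1%R u i :: behead v :> seq _.
  by rewrite v_rot /rot (drop_nth 1%R iu).
have v'v : weight v' < weight v.
  rewrite v_cons /weight !big_cons ltn_add2r.
  exact: letter_weight_gt1.
have v'E : v' \in E by exact: positive_words_lt v'v.
have wv : weight v = weight u by rewrite v_rot weight_rot.
rewrite -(porbit_joined_rot positive_words_rot sB sE joined i uE) -/v.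
rewrite -(IH v') //; last by rewrite -wv in un; exact: leq_trans v'v un.
by apply/eqP; rewrite eq_porbit_mem joined.
Qed.
End PositiveWords.

(** * Counting the words that [negrev] rotates, and building the sequence *)

Section Symmetric.
Variables (k' m : nat).
Local Notation k := k'.+3.
Local Notation word := (m.+1.-tuple 'Z_k).
Implicit Types (u v : word).

(** Comparing letters at position [m - l] shows that the first [j] letters and the remaining ones
    form two blocks, each equal to its own reversed negation. *)
Lemma nth_symmetric u j l : j < m.+1 -> negrev u = rot j u :> seq _ ->
  l < m.+1 ->
  nth 0%R u l = (- nth 0%R u (if l < j then j.-1 - l else j + m - l)%N)%R.
Proof.
move=> jm uj lm.
have := congr1 (fun w => nth 0%R w (m - l)) uj.
rewrite /= (nth_map 0%R) ?size_rev ?size_tuple ?ltnS ?leq_subr //.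
rewrite nth_rev ?size_tuple ?ltnS ?leq_subr // subSS subKn; last by rewrite -ltnS.
move=> /(congr1 -%R%R); rewrite opprK => ->; congr (- _)%R.
rewrite /rot nth_cat size_drop size_tuple nth_drop.
have [lj|jl] := ltnP l j.
  rewrite ifF ?nth_take; [by congr nth; lia|by lia|by lia].
by rewrite ifT; [congr nth; lia|lia].
Qed.

(** The first halves of the two blocks, rounded up, determine [u]; together they have at most
    [m.+1./2.+1] letters. The map [g] records them. *)
Lemma card_symmetric j : j < m.+1 ->
  #|[set u : word | negrev u == rot j u :> seq _]%SET| <= k ^ (m.+1./2.+1).
Proof.
move=> jm.
pose g u := [ffun i : 'I_(m.+1./2.+1) =>
  nth 0%R u (if i < uphalf j then (i : nat) else j + (i - uphalf j))].
have g_inj : {in [set u : word | negrev u == rot j u :> seq _]%SET &, injective g}.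
  move=> u v; rewrite !inE => /eqP uj /eqP vj /ffunP guv.
  have {guv} guv i : i < m.+1./2.+1 ->
      let i' := (if i < uphalf j then i else j + (i - uphalf j)) in
      nth 0%R u i' = nth 0%R v i'.
    by move=> ilt; have := guv (Ordinal ilt); rewrite !ffunE.
  apply/val_inj/(@eq_from_nth _ 0%R); first by rewrite !size_tuple.
  move=> l; rewrite size_tuple => lm.
  have [lj|jl] := ltnP l j.
    have low i : i < uphalf j -> nth 0%R u i = nth 0%R v i.
      by move=> ij; have /= := guv i; rewrite ij; apply; lia.
    have [/low //|jl] := ltnP l (uphalf j).
    rewrite (nth_symmetric jm uj lm) (nth_symmetric jm vj lm) lj.
    by congr (- _)%R; apply: low; lia.
  have high t : uphalf j + t < m.+1./2.+1 -> nth 0%R u (j + t) = nth 0%R v (j + t).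
    move=> tm; have /= := guv _ tm.
    by rewrite ltnNge leq_addr /= addKn.
  have [lt|ge] := ltnP (uphalf j + (l - j)) (m.+1./2.+1).
    by have := high _ lt; rewrite subnKC.
  rewrite (nth_symmetric jm uj lm) (nth_symmetric jm vj lm) ltnNge jl /=.
  have -> : j + m - l = j + (m - l) by lia.
  by congr (- _)%R; apply: high; lia.
rewrite -(card_in_imset g_inj); apply: leq_trans (max_card _) _.
by rewrite card_ffun !card_ord.
Qed.

Lemma card_negrev_porbit :
  #|[set u : word | negrev u \in porbit (rot_perm _ m) u]%SET|
    <= m.+1 * k ^ (m.+1./2.+1).
Proof.
pose F (j : 'I_m.+1) := [set u : word | negrev u == rot j u :> seq _]%SET.
apply: (@leq_trans #|\bigcup_j F j|).
  apply/subset_leq_card/fintype.subsetP => u; rewrite inE => /porbit_rot_permP[j jm uj].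
  by apply/bigcupP; exists (Ordinal jm); rewrite // inE uj.
apply: (@leq_trans (\sum_j #|F j|)).
  elim/big_ind2: _ => [|a b c d ab cd|//]; first by rewrite cards0.
  by apply: leq_trans (leq_card_setU _ _) (leq_add _ _).
rewrite -[X in _ <= X * _]card_ord -sum_nat_const.
by apply: leq_sum => j _; exact: card_symmetric.
Qed.

Lemma card_positive_words :
  k ^ m.+1 <= 2 * #|positive_words k' m| + m.+1 * k ^ (m.+1./2.+1).
Proof.
pose E := positive_words k' m.
pose F := [set u : word | negrev u \in porbit (rot_perm _ m) u]%SET.
have -> : k ^ m.+1 = #|[set: word]%SET| by rewrite cardsT card_tuple card_ord.
have sub : [set: word]%SET \subset ((E :|: (@negrev k' m) @^-1: E) :|: F)%SET.
  apply/fintype.subsetP => u _; rewrite !inE negrevK.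
  (* Outside [E] and its preimage both weights and ranks agree; as ranks are injective on classes,
     [u] and [negrev u] are rotations of each other. *)
  case: ltngtP => //= _; case: ltngtP => //= eq_rk.
  rewrite -eq_porbit_mem; apply/eqP/enum_rank_inj/val_inj.
  exact/esym.
apply: leq_trans (subset_leq_card sub) _.
apply: leq_trans (leq_card_setU _ _) _.
apply: leq_add card_negrev_porbit.
apply: leq_trans (leq_card_setU _ _) _.
by rewrite card_preimset ?addnn ?mul2n //; exact: inv_inj (@negrevK _ _).
Qed.

(** Joining makes [E] a single cycle; its first letters form [S], whose windows are the words of
    [E], and [negrev] maps these outside [E]. *)
Lemma negative_orientable_ex :
  exists S : nat -> 'Z_k, negative_orientable m.+1 S #|positive_words k' m|.
Proof.
have [s [sB sE joined]] := joined_perm_ex (@positive_words_rot k' m).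
have orb := porbit_joined_ones sB sE joined.
have oneE := ones_positive k' m.
have orbE : porbit s (ones k' m) = positive_words k' m.
  apply/setP => u; apply/idP/idP => [/porbitP[i ->]|/orb <-]; last exact: porbit_id.
  by elim: i => [|i IH]; rewrite ?expg0 ?perm1 // expgSr permM sE.
pose w i := iter i s (ones k' m).
have wE i : w i \in positive_words k' m.
  by rewrite -orbE; apply/porbitP; exists i; rewrite permX.
pose S i : 'Z_k := nth 0%R (w i) 0.
have winS i : window S m.+1 i = w i.
  apply/(@eq_from_nth _ 0%R); rewrite ?size_map ?size_iota ?size_tuple // => j jm.
  rewrite (nth_map 0) ?size_iota // nth_iota // add0n.
  by rewrite /S nth_debruijn_iter.
have S_inj i j : window S m.+1 i = window S m.+1 j ->
    i = j %[mod #|positive_words k' m|].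
  by rewrite !winS => /val_inj; rewrite -orbE; exact: iter_perm_inj.
exists S; split; last first.
  move=> i j; rewrite !winS => ij.
  have := positive_words_negrev (wE j).
  by rewrite (_ : negrev (w j) = w i) ?wE //; exact/val_inj/esym.
split=> //; split.
- by apply/card_gt0P; exists (ones k' m).
- by move=> i; rewrite /S /w -orbE iterD iter_porbit.
- move=> q q0 Sq.
  (* A shift by [q] that fixes [S] repeats the window at 0, so the cycle length divides [q]. *)
  have /S_inj : window S m.+1 q = window S m.+1 0.
    by apply/eq_map => j; rewrite add0n addnC.
  by rewrite mod0n => /eqP; apply: dvdn_leq.
Qed.
End Symmetric.

(** * Two-sided bounds on the maximal period *)

Lemma max_period_ge n k : 0 < n -> 2 < k ->
  k ^ n <= 2 * max_period n k + n * k ^ (n./2.+1).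
Proof.
case: n => // m; case: k => [|[|[|k']]] // _ _.
apply: leq_trans (card_positive_words k' m) _.
rewrite leq_add2r leq_mul2l /=.
have [S HS] := negative_orientable_ex k' m.
have [_ /(_ S)] := @max_periodP m.+1 k'.+3 isT isT; exact.
Qed.

Lemma max_period_le n k : 0 < n -> 2 < k -> 2 * max_period n k <= k ^ n.
Proof.
case: n => // m; case: k => [|[|[|k']]] // _ _.
have [[S [[[p0 per _] inj] neg]] _] := @max_periodP m.+1 k'.+3 isT isT.
set p := max_period _ _ in p0 per inj *.
have sz i : size (window S m.+1 i) == m.+1 by rewrite size_map size_iota.
pose f (i : 'I_p) : m.+1.-tuple 'Z_(k'.+3) := Tuple (sz i).
have finj : injective f.
  by move=> i j /(congr1 val) /= /inj; rewrite !modn_small // => /val_inj.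
pose F := (f @: 'I_p)%SET.
have cF : #|F| = p by rewrite card_imset // card_ord.
(* As [negrev] is an involution, this preimage is the set of reversed negations of windows. *)
have dis : (F :&: (@negrev k' m) @^-1: F = finset.set0)%SET.
  apply/setP => u; rewrite !inE; apply/negP => /andP[/imsetP[i _ ->] /imsetP[j _]].
  by move=> /(congr1 val) /esym; exact: neg.
have := cardsUI F ((@negrev k' m) @^-1: F)%SET.
rewrite dis cards0 addn0 card_preimset; last exact: inv_inj (@negrevK _ _).
rewrite cF addnn -mul2n => <-; apply: leq_trans (max_card _) _.
by rewrite card_tuple card_ord.
Qed.

Local Open Scope classical_set_scope.
Local Open Scope ring_scope.

(** * Comparison with the closed formula and passage to the limit *)

Section Asymptotics.
Variable R : realType.

(** The common error term of [2 s_k(n-1)] and twice the maximal period, relative to the main term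
    [k^n]. *)
Definition rel_error (n k : nat) : R :=
  n%:R * k%:R ^+ n./2.+1 / k%:R ^+ n.

(** In units of [n * X], the odd case costs at most 2, and the four terms of the even case at most
    5/2, 2, 2 and 2, which 9 covers. *)
Lemma s_val_dist (n k : nat) : (2 < n)%N -> (2 < k)%N ->
  `|2 * s_val R k n.-1 - k%:R ^+ n| <= 9 * (n%:R * k%:R ^+ n./2.+1).
Proof.
move=> n2 k2; rewrite /s_val prednK; last exact: leq_trans n2.
set m := (n %/ 2 ^ logn 2 n)%N; set d : R := (delta k)%:R; set K : R := k%:R.
set X := K ^+ n./2.+1.
have K3 : 3 <= K by rewrite ler_nat.
have K1 : 1 <= K by lra.
have N1 : 1 <= n%:R :> R by rewrite ler1n (leq_trans _ n2).
have mN : m%:R <= n%:R :> R by rewrite ler_nat leq_div.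
have m0 : 0 <= m%:R :> R by [].
have d12 : 1 <= d <= 2 by rewrite /d /delta; case: odd; rewrite ?lexx ?ler1n ?ler_nat.
have KX j : (j <= n./2.+1)%N -> 1 <= K ^+ j <= X.
  by move=> jn; rewrite exprn_ege1 //= ler_eXn2l //; lra.
have NX : n%:R <= n%:R * X by rewrite ler_peMr //; case/andP: (KX 0%N isT).
have [od|ev] := boolP (odd n).
  have /andP[b1 bX] : 1 <= K ^+ ((n - 1) %/ 2) <= X by apply: KX; lia.
  set b := K ^+ _ in b1 bX *.
  have Nb : n%:R * b <= n%:R * X by rewrite ler_wpM2l.
  have Nb' : n%:R <= n%:R * b by rewrite ler_peMr.
  set y := n%:R * (b - 1) + 1.
  have y0 : 0 <= y by rewrite /y mulrBr; lra.
  have yX : y <= n%:R * X by rewrite /y mulrBr; lra.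
  rewrite (_ : _ - _ = - (d * y)); last by field.
  by rewrite normrN ger0_norm; nra.
have /andP[a1 aX] : 1 <= K ^+ ((m - 1) %/ 2) <= X.
  apply: KX; have : (m <= n)%N by exact: leq_div.
  by lia.
have cX : K ^+ ((n - 2) %/ 2) * K <= X.
  by rewrite -exprSr ler_eXn2l; [lia | lra].
have c1 : 1 <= K ^+ ((n - 2) %/ 2) by rewrite exprn_ege1.
set a := K ^+ ((m - 1) %/ 2) in a1 aX *.
set c := K ^+ ((n - 2) %/ 2) in c1 cX *.
have Na : n%:R * a <= n%:R * X by rewrite ler_wpM2l.
have Na0 : 0 <= n%:R * a by rewrite mulr_ge0 //; lra.
have Ma : m%:R * (a - 1) <= n%:R * X by apply: ler_pM => //; lra.
have Ma0 : 0 <= m%:R * (a - 1) by rewrite mulr_ge0 //; lra.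
have c0 : 0 <= c by lra.
have d2 : d ^+ 2 <= 4 by rewrite expr2; nra.
have d20 : 0 <= d ^+ 2 by exact: sqr_ge0.
have dK0 : 0 <= c * (d ^+ 2 + K) by rewrite mulr_ge0 //; lra.
(* Since [d ^+ 2 <= 4 <= 4 * K], the bracket is at most [5 * K], and [c * K <= X]. *)
have dK : c * (d ^+ 2 + K) <= 5 * X.
  apply: (@le_trans _ _ (c * (5 * K))); first by rewrite ler_wpM2l //; lra.
  by rewrite mulrCA ler_wpM2l.
have Nd : n%:R * (c * (d ^+ 2 + K)) <= n%:R * (5 * X) by rewrite ler_wpM2l.
have Nd0 : 0 <= n%:R * (c * (d ^+ 2 + K)) by rewrite mulr_ge0.
rewrite (_ : _ - _ = - (n%:R * (c * (d ^+ 2 + K)) / 2) + d * (n%:R * a)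
   - d * (m%:R * (a - 1)) - d); last by field.
have : 0 <= d * (n%:R * a) <= 2 * (n%:R * X) by nra.
have : 0 <= d * (m%:R * (a - 1)) <= 2 * (n%:R * X) by nra.
by rewrite ler_norml; lra.
Qed.

Lemma max_period_dist (n k : nat) : (0 < n)%N -> (2 < k)%N ->
  `|2 * (max_period n k)%:R - k%:R ^+ n| <= n%:R * k%:R ^+ n./2.+1 :> R.
Proof.
move=> n0 k2.
have := max_period_le n0 k2; rewrite -(ler_nat R) natrM natrX.
have := max_period_ge n0 k2; rewrite -(ler_nat R) natrD !natrM !natrX.
by rewrite ler_norml; lra.
Qed.

Lemma cvg1_dist (f e : nat -> R) (c : R) :
  (\forall i \near \oo, `|f i - 1| <= c * e i) -> e @ \oo --> (0 : R) ->
  f @ \oo --> (1 : R).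
Proof.
move=> fe e0.
have ce (b : R) : (fun i => 1 + b * e i) @ \oo --> (1 : R).
  rewrite -[X in _ --> X]addr0 -[X in _ --> _ + X](mulr0 b).
  by apply: cvgD; [exact: cvg_cst | apply: cvgMr].
apply: squeeze_cvgr (ce (- c)) (ce c).
by apply: filterS fe => i; rewrite ler_norml; lra.
Qed.

(** Numerator and denominator, doubled and divided by [k^n], both tend to 1. Letting [n] and [k]
    both depend on [i] treats the two limits at once. *)
Lemma cvg_ratio (n k : nat -> nat) :
    (\forall i \near \oo, (2 < n i)%N /\ (2 < k i)%N) ->
    (fun i => rel_error (n i) (k i)) @ \oo --> (0 : R) ->
  (fun i => s_val R (k i) (n i).-1 / (max_period (n i) (k i))%:R) @ \oo
    --> (1 : R).
Proof.
move=> nk e0.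
pose Q i : R := (k i)%:R ^+ n i.
have dist (x c : R) i : (2 < k i)%N ->
    `|2 * x - Q i| <= c * ((n i)%:R * (k i)%:R ^+ (n i)./2.+1) ->
    `|2 * x / Q i - 1| <= c * rel_error (n i) (k i).
  move=> k2 H; have Q0 : 0 < Q i by rewrite exprn_gt0 // ltr0n (leq_trans _ k2).
  rewrite (_ : _ - 1 = (2 * x - Q i) / Q i); last by field; rewrite gt_eqF.
  by rewrite normrM normfV (gtr0_norm Q0) /rel_error mulrA ler_pM2r ?invr_gt0.
have sQ : (fun i => 2 * s_val R (k i) (n i).-1 / Q i) @ \oo --> (1 : R).
  apply: (cvg1_dist (c := 9)) e0; apply: filterS nk => i [n2 k2].
  by apply: dist => //; exact: s_val_dist.
have LQ : (fun i => 2 * (max_period (n i) (k i))%:R / Q i) @ \oo --> (1 : R).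
  apply: (cvg1_dist (c := 1)) e0; apply: filterS nk => i [n2 k2].
  by apply: dist => //; rewrite mul1r max_period_dist // (leq_trans _ n2).
rewrite -[X in _ --> X](divr1 1).
apply: cvg_trans (cvgM sQ (cvgV (oner_neq0 R) LQ)).
apply: near_eq_cvg; apply: filterS nk => i [n2 k2] /=.
have Q0 : Q i != 0.
  by rewrite expf_neq0 // pnatr_eq0 -lt0n (leq_trans _ k2).
by rewrite invf_div mulrA divfK // -mulf_div divff ?mul1r // pnatr_eq0.
Qed.

(** From [q = 2] on, [3 q^2 >= (q+1)^2] carries the induction. Exponential growth thus absorbs the
    factor [n] of the error. *)
Lemma sqr_le_exp3 q : (q ^ 2 <= 3 ^ q)%N.
Proof.
elim: q => // -[|[|q]] // IH; rewrite expnS.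
by apply: leq_trans (leq_mul (leqnn 3) IH); nia.
Qed.

(** The error is [n k / k^(uphalf n)], and [n (n+1) <= 8 (uphalf n)^2 <= 8 k^(uphalf n)] bounds it
    by [8 k / (n+1)]. *)
Lemma rel_error_cvg_n k : (2 < k)%N ->
  (fun n => rel_error n k) @ \oo --> (0 : R).
Proof.
move=> k2.
have h0 : (fun n => (8 * k%:R) * harmonic n) @ \oo --> (0 : R).
  rewrite -[X in _ --> X](mulr0 (8 * k%:R)).
  by apply: cvgMr; exact: cvg_harmonic.
apply: squeeze_cvgr (cvg_cst 0) h0; exists 1%N => // n /= n1.
have K0 : 0 < k%:R :> R by rewrite ltr0n (leq_trans _ k2).
rewrite /rel_error divr_ge0 ?mulr_ge0 ?exprn_ge0 //= ler_pdivrMr ?exprn_gt0 //.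
rewrite /harmonic -(ler_pM2r (_ : 0 < n.+1%:R)) ?ltr0n //.
rewrite (mulrAC _ (k%:R ^+ n)) divfK ?pnatr_eq0 //.
rewrite -!natrX -!natrM ler_nat.
have -> : (k ^ n = k ^ n./2 * k ^ uphalf n)%N by rewrite -expnD; congr expn; lia.
have : (3 ^ uphalf n <= k ^ uphalf n)%N by rewrite leq_exp2r //; lia.
have := sqr_le_exp3 (uphalf n).
rewrite (expnS k n./2); move: (k ^ n./2)%N (3 ^ _)%N (k ^ _)%N => x y z qy yz.
have nn : (n * n.+1 <= 8 * z)%N.
  have q2 := leq_trans qy yz.
  apply: (@leq_trans (2 * uphalf n * (4 * uphalf n))); first by apply: leq_mul; lia.
  by rewrite mulnACA mulnn leq_mul2l.
rewrite (_ : n * _ * _ = k * x * (n * n.+1))%N; last by lia.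
by rewrite (_ : 8 * k * _ = k * x * (8 * z))%N ?leq_mul2l ?nn ?orbT //; lia.
Qed.

(** For [n >= 3] the exponent [n./2 + 2] is at most [n], so the error is at most [n / k], hence at
    most [2 n / (k+1)]. *)
Lemma rel_error_cvg_k n : (2 < n)%N ->
  (fun k => rel_error n k) @ \oo --> (0 : R).
Proof.
move=> n2.
have h0 : (fun k => (2 * n%:R) * harmonic k) @ \oo --> (0 : R).
  rewrite -[X in _ --> X](mulr0 (2 * n%:R)).
  by apply: cvgMr; exact: cvg_harmonic.
apply: squeeze_cvgr (cvg_cst 0) h0; exists 1%N => // k /= k1.
have K0 : 0 < k%:R :> R by rewrite ltr0n.
rewrite /rel_error divr_ge0 ?mulr_ge0 ?exprn_ge0 //= ler_pdivrMr ?exprn_gt0 //.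
rewrite /harmonic -(ler_pM2r (_ : 0 < k.+1%:R)) ?ltr0n //.
rewrite (mulrAC _ (k%:R ^+ n)) divfK ?pnatr_eq0 //.
rewrite -!natrX -!natrM ler_nat.
have : (k ^ n./2.+2 <= k ^ n)%N by rewrite leq_pexp2l //; lia.
rewrite expnSr; move: (k ^ n./2.+1)%N (k ^ n)%N => x y xy.
have xk : (x * k.+1 <= 2 * y)%N.
  by apply: (@leq_trans (x * (2 * k))); [rewrite leq_mul2l; lia | lia].
by rewrite -mulnA (mulnC 2%N n) -(mulnA n 2%N) leq_mul2l xk orbT.
Qed.

End Asymptotics.

Theorem theorem5p3 (R : realType) :
  (forall k : nat, (3 <= k)%N ->
    (fun n : nat => s_val R k n.-1 / (max_period n k)%:R) @ \oo --> (1 : R)) /\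
  (forall n : nat, (3 <= n)%N ->
    (fun k : nat => s_val R k n.-1 / (max_period n k)%:R) @ \oo --> (1 : R)).
Proof.
split=> [k k2|n n2].
  apply: (@cvg_ratio R id (fun=> k)); last exact: rel_error_cvg_n.
  by exists 3%N.
apply: (@cvg_ratio R (fun=> n) id); last exact: rel_error_cvg_k.
by exists 3%N.
Qed.
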